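(* Let $g\in\mathcal{L}$ and let $\lambda\in(0,1)$. Then the inverse of the function $f_\lambda$ is given by $$ f_\lambda^{-1}(x)=x\,g^{-1}\left(-\frac{1-\lambda}{\lambda}\,g\left(\frac1x\right)\right) $$ for all $x$ in the range of $f_\lambda$ (the domain of $f_\lambda^{-1}$).
   Context: A real-valued function $g$ on $(0,\infty)$ is operator monotone if $B\le A$ implies $g(B)\le g(A)$ for all self-adjoint bounded operators $A,B$ on a Hilbert space with spectra in $(0,\infty)$ (for every Hilbert space). $\mathcal{L}$ denotes the set of all operator monotone functions $g$ on $(0,\infty)$ with $g(1)=0$ and $g'(1)=1$. For $g\in\mathcal{L}$, $g^{-1}$ denotes the inverse of $g$ on the range of $g$. For $\lambda\in[0,1]$ the function $f_\lambda:(0,\infty)\to(0,\infty)$ is defined by letting $f_\lambda(x)$ be the unique $y>0$ with $$(1-\lambda)\,g\left(\frac{1}{y}\right)+\lambda\, g\left(\frac{x}{y}\right)=0 .$$ (In particular $f_0(x)=1$ and $f_1(x)=x$.) It is the representing function of the $\lambda$-weighted two-variable operator mean obtained from the generalized Karcher equation of $g$. *)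

(* Defs.v *)
From mathcomp Require Export all_boot all_order all_algebra.
From mathcomp Require Export complex.
From mathcomp Require Export all_classical all_reals all_analysis.
Export numFieldNormedType.Exports.

Set Implicit Arguments.
Unset Strict Implicit.
Unset Printing Implicit Defensive.

Import Order.TTheory GRing.Theory Num.Theory.
Local Open Scope classical_set_scope.
Local Open Scope ring_scope.
Local Open Scope complex_scope.

Section HilbertSpace.
Context {R : realType} {V : lmodType R[i]} (dot : {dot V for @Num.conj R[i]}).

Definition hnorm (x : V) : R := Num.sqrt (complex.Re (dot x x)).

(** [dot] makes [V] a complex Hilbert space. *)
Definition hilbert : Prop :=
  forall u : nat -> V,
    (forall e : R, 0 < e -> exists N : nat,
       forall m n : nat, (N <= m)%N -> (N <= n)%N -> hnorm (u m - u n) < e) ->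
    exists l : V, forall e : R, 0 < e -> exists N : nat,
      forall n : nat, (N <= n)%N -> hnorm (u n - l) < e.

Definition bounded_op (A : V -> V) : Prop :=
  exists M : R, forall x, hnorm (A x) <= M * hnorm x.

Definition self_adjoint (A : V -> V) : Prop :=
  forall x y, dot (A x) y = dot x (A y).

(** The order of [R[i]] is partial: [a <= b] says that [b - a] is real and
    nonnegative. *)
Definition op_le (B A : V -> V) : Prop := forall x, dot (B x) x <= dot (A x) x.

Definition spectrum (A : V -> V) : set R[i] :=
  [set z | ~ exists S : {linear V -> V}, bounded_op S /\
             forall x, S (A x - z *: x) = x /\ A (S x) - z *: S x = x].

Definition poly_op (p : {poly R}) (A : V -> V) (x : V) : V :=
  \sum_(k < size p) (p`_k)%:C *: iter k A x.

(** [T = g(A)] in the continuous functional calculus of a self-adjoint [A]: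
    [T] is the operator-norm limit of [p_n(A)] for real polynomials [p_n]
    tending to [g] uniformly on the spectrum of [A], which is a compact set of
    reals.  Such a [T] is unique, and it exists iff [g] is continuous on that
    spectrum. *)
Definition is_fcalc (g : R -> R) (A T : V -> V) : Prop :=
  forall e : R, 0 < e -> exists p : {poly R},
    (forall r : R, spectrum A r%:C -> `|p.[r] - g r| <= e) /\
    (forall x, hnorm (poly_op p A x - T x) <= e * hnorm x).

End HilbertSpace.

Section GeneralizedKarcher.
Context {R : realType}.
Implicit Types (g : R -> R) (lam x y : R).

(** A function on (0, +oo) is a total function whose values outside (0, +oo)
    are irrelevant.  Continuity of [g] is not assumed: on a finite-dimensional
    space [g(A)] exists for every [g], which already forces an operator
    monotone function to be continuous. *)
Definition operator_monotone g : Prop :=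
  forall (V : lmodType R[i]) (dot : {dot V for @Num.conj R[i]}), hilbert dot ->
  forall A B : {linear V -> V},
    bounded_op dot A -> bounded_op dot B ->
    self_adjoint dot A -> self_adjoint dot B ->
    (forall z, spectrum dot A z -> 0 < z) ->
    (forall z, spectrum dot B z -> 0 < z) ->
    op_le dot B A ->
  forall gA gB : {linear V -> V},
    is_fcalc dot g A gA -> is_fcalc dot g B gB -> op_le dot gB gA.

Definition karcher_class g : Prop :=
  [/\ operator_monotone g, g 1 = 0 & is_derive (1 : R) (1 : R) g 1].

Definition karcher_root g lam x : set R :=
  [set y | 0 < y /\ (1 - lam) * g (1 / y) + lam * g (x / y) = 0].

(** "The unique positive root", with the junk value 0 if there is none or
    more than one. *)
Definition f_lambda g lam x : R := xget 0 [set y | unique (karcher_root g lam x) y].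

(** [h] is restricted to (0, +oo); this is its inverse on the range of that
    restriction only when the restriction is injective. *)
Definition pos_inv (h : R -> R) : R -> R := 'pinv_(fun=> 0) `]0, +oo[ h.

End GeneralizedKarcher.

(* Main.v *)
Require Import Defs.
From mathcomp Require Import ring lra.

(** Once [g] is known to be strictly increasing and continuous on (0, +oo),
the proposition is elementary.  With [u = 1 / y] the Karcher equation reads
[(1 - lam) * g u + lam * g (x * u) = 0]; its left side is continuous and
strictly increasing in [u], nonpositive at [min 1 (1/x)] and nonnegative at
[max 1 (1/x)], because [g 1 = 0].  Hence it has exactly one root, and
[f_lambda g lam x] is that root for every [x > 0] ([f_lambdaP]).  Writing
[y = f_lambda g lam x], the equation says
[g (x / y) = - ((1 - lam) / lam) * g (1 / y)]; as [g] is injective, [y]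
determines [x], and applying the inverse of [g] gives the formula.

The substance is therefore to extract these two properties from operator
monotonicity and [g'(1) = 1].  Operators on C^1 and C^2 suffice.  A real
symmetric matrix annihilated by [(X - a) (X - b)] has its spectrum in
[{a, b}], so [g] of it is any affine polynomial in it interpolating [g] at
[a] and [b]; no diagonalization is involved ([opmono_le_quad_form]).
For n = 1 this says that [g] is nondecreasing.  For n = 2, take
[0 < c < a < d < b].  By interlacing, some rank-one perturbation [A >= B] of
[B = diag (c, d)] has eigenvalues [a] and [b], and nonnegativity of the
determinant of [g(A) - g(B)] is
[[
  P * Q * (d - c) + Q * m * (b - d) <= P * m * (b - c)
]]
where [P], [Q], [m] are the slopes of [g] over [c, a], over [a, d] and over
[a, b] ([opmono_interlacing]).

This inequality does all the work.  If [g] takes equal values at two points,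
moving them into the roles of [d, b] and then of [c, a] forces [g] to be
constant ([opmono_const]), against [g'(1) = 1]; so [g] is
strictly increasing.  Then [P > 0] can be cancelled, leaving
[Q * (d - c) <= m * (b - c)]: with [c] and [b] kept away from [a] and [d],
this bounds the slope [Q] locally uniformly, so [g] is locally Lipschitz
([karcher_class_lipschitz]) and continuous. *)

Set Implicit Arguments.
Unset Strict Implicit.
Unset Printing Implicit Defensive.

Import Order.TTheory GRing.Theory Num.Theory.
Local Open Scope classical_set_scope.
Local Open Scope ring_scope.

(** * The Hilbert space of complex row vectors *)

Section UnitarySpace.
Local Open Scope complex_scope.
Context {R : realType} {n : nat}.
Local Notation C := R[i].
Local Notation cdot := (@dotmx C n).
Implicit Types x : 'rV[C]_n.

Lemma hnorm_ge0 x : 0 <= hnorm cdot x.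
Proof. exact: sqrtr_ge0. Qed.

Lemma sqr_hnormC x : ((hnorm cdot x) ^+ 2)%:C = \sum_k `|x 0 k| ^+ 2.
Proof.
have dE : cdot x x = \sum_k `|x 0 k| ^+ 2.
  by rewrite dotmxE mxE; apply: eq_bigr => k _; rewrite !mxE -normCK.
have : 0 <= cdot x x by rewrite dE sumr_ge0// => k _; rewrite exprn_ge0.
rewrite /hnorm -dE => d0; have dR := RRe_real (ger0_real d0).
by rewrite sqr_sqrtr// -(@lecR R) dR.
Qed.

Lemma sqr_hnorm x :
  (hnorm cdot x) ^+ 2 = \sum_k (complex.Re (x 0 k) ^+ 2 + complex.Im (x 0 k) ^+ 2).
Proof.
apply: (@complexI R); rewrite sqr_hnormC rmorph_sum.
by apply: eq_bigr => k _; rewrite /= add_Re2_Im2.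
Qed.

Lemma hnorm_lt x (e : R) : 0 < e -> (hnorm cdot x < e) = (hnorm cdot x ^+ 2 < e ^+ 2).
Proof. by move=> e0; rewrite ltr_pXn2r// ?nnegrE ?hnorm_ge0// ltW. Qed.

Lemma cauchy_cvg_real (u : nat -> R) :
  (forall e : R, 0 < e -> exists N : nat,
     forall m n : nat, (N <= m)%N -> (N <= n)%N -> `|u m - u n| < e) ->
  cvgn u.
Proof.
move=> cu; apply/cauchy_cvgP/cauchy_exP => e e0.
have [N NP] := cu e e0; exists (u N); exists N => // k /= Nk.
by rewrite /ball/=; apply: NP.
Qed.

(** Completeness is inherited from the reals, coordinate by coordinate: real
and imaginary parts of each coordinate are dominated by the norm, and the
squared norm is a finite sum of squares of such parts. *)
Lemma hilbert_dotmx : hilbert cdot.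
Proof.
move=> u cu.
(* phi stands for the real or the imaginary part. *)
have cvg_coord (phi : C -> R) k : {morph phi : a b / a - b} ->
    (forall a, phi a ^+ 2 <= complex.Re a ^+ 2 + complex.Im a ^+ 2) ->
    cvgn (fun m => phi (u m 0 k)).
  move=> phiB phi_le; apply: cauchy_cvg_real => e e0.
  have [N NP] := cu e e0; exists N => i j Ni Nj; have := NP i j Ni Nj.
  rewrite hnorm_lt// => /le_lt_trans ule.
  rewrite -(@ltr_pXn2r _ 2)// ?nnegrE ?normr_ge0 ?(ltW e0)//; apply: ule.
  rewrite sqr_hnorm (bigD1 k)//= real_normK ?num_real// -phiB !mxE.
  rewrite (le_trans (phi_le _))// lerDl sumr_ge0// => l _.
  by rewrite addr_ge0// sqr_ge0.
have cvgRe k : cvgn (fun m => complex.Re (u m 0 k)).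
  by apply: cvg_coord => [a b|a]; rewrite ?raddfB// lerDl sqr_ge0.
have cvgIm k : cvgn (fun m => complex.Im (u m 0 k)).
  by apply: cvg_coord => [a b|a]; rewrite ?raddfB// lerDr sqr_ge0.
pose l : 'rV[C]_n := \row_k (limn (fun m => complex.Re (u m 0 k)) +i*
                             limn (fun m => complex.Im (u m 0 k))).
exists l => e e0.
pose d k m := (complex.Re (u m 0 k) - complex.Re (l 0 k)) ^+ 2 +
              (complex.Im (u m 0 k) - complex.Im (l 0 k)) ^+ 2.
have : hnorm cdot (u m - l) ^+ 2 @[m --> \oo] --> (0 : R).
  have -> : (fun m => hnorm cdot (u m - l) ^+ 2) = (fun m => \sum_k d k m).
    apply/funext => m; rewrite sqr_hnorm; apply: eq_bigr => k _.
    by rewrite /d !mxE !raddfB.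
  rewrite [X in _ --> X](_ : _ = \sum_(k < n) (0 ^+ 2 + 0 ^+ 2)); last first.
    by rewrite big1// => k _; rewrite expr0n addr0.
  apply: (cvg_big (op := +%R) add_continuous) => k _.
  have cvg0 (v : nat -> R) : cvgn v -> (v m - limn v) ^+ 2 @[m --> \oo] --> (0 ^+ 2 : R).
    by move=> cv; apply: cvgM; rewrite -[X in _ --> X](subrr (limn v));
      (apply: cvgB; [exact: cv | exact: cvg_cst]).
  by rewrite /d mxE; apply: cvgD; apply: cvg0; [exact: cvgRe|exact: cvgIm].
move=> /cvgrPdist_lt /(_ (e ^+ 2)) []; first by rewrite exprn_gt0.
move=> N _ NP; exists N => m Nm; rewrite hnorm_lt//.
by have := NP m Nm; rewrite sub0r normrN ger0_norm// exprn_ge0// hnorm_ge0.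
Qed.

Lemma bounded_mulmxr (M : 'M[C]_n) : bounded_op cdot (mulmxr M).
Proof.
have xk x k : `|x 0 k| <= (hnorm cdot x)%:C.
  rewrite -(@ler_pXn2r _ 2)// ?nnegrE ?lecR ?hnorm_ge0//.
  rewrite -[X in _ <= X]rmorphXn /= sqr_hnormC (bigD1 k)//= lerDl.
  by rewrite sumr_ge0// => l _; rewrite exprn_ge0.
have [k k0 kE] : exists2 k : R, 0 <= k & k%:C = \sum_j (\sum_i `|M i j|) ^+ 2.
  pose K : C := \sum_j (\sum_i `|M i j|) ^+ 2.
  have K0 : 0 <= K by rewrite sumr_ge0// => j _; rewrite exprn_ge0// sumr_ge0.
  have KE := RRe_real (ger0_real K0).
  exists (complex.Re K) => //; by rewrite -(@lecR R) KE.
exists (Num.sqrt k) => x.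
rewrite -(@ler_pXn2r _ 2)// ?nnegrE ?mulr_ge0 ?hnorm_ge0 ?sqrtr_ge0//.
rewrite [leRHS]exprMn (sqr_sqrtr k0) -(@lecR R).
rewrite [leRHS](rmorphM (real_complex R))/= kE [leLHS]sqr_hnormC mulr_suml.
apply: ler_sum => j _; rewrite rmorphXn/= -exprMn ler_pXn2r ?nnegrE//; last first.
  by rewrite mulr_ge0 ?sumr_ge0// lecR hnorm_ge0.
rewrite mxE (le_trans (ler_norm_sum _ _ _))// mulr_suml ler_sum// => i _.
by rewrite normrM mulrC ler_wpM2l.
Qed.

(** In finite dimension an injective [M - z] is invertible, and its inverse,
being given by a matrix, is bounded. *)
Lemma spectrum_mulmxr (M : 'M[C]_n) z : spectrum cdot (mulmxr M) z -> eigenvalue M z.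
Proof.
move=> sz; apply: contra_notT sz; rewrite /eigenvalue negbK kermx_eq0 row_free_unit => U.
exists (mulmxr (invmx (M - z%:M))); split; first exact: bounded_mulmxr.
move=> x /=; rewrite -mul_mx_scalar -mulmxBr mulmxK//; split=> //.
by rewrite -mul_mx_scalar -mulmxBr mulmxKV.
Qed.

End UnitarySpace.

(** * Real symmetric matrices as operators *)

Section RealSymmetric.
Local Open Scope complex_scope.
Context {R : realType} {n : nat}.
Local Notation C := R[i].
Local Notation cdot := (@dotmx C n).
Local Notation cmx := (map_mx (real_complex R)).
Implicit Types M N : 'M[R]_n.

(** An affine polynomial that agrees with [g] on the spectrum is at distance
0 from [g] there, so it serves as approximation for every precision. *)
Lemma is_fcalc_affine (g : R -> R) (M : 'M[C]_n) (c0 c1 : R) :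
  (forall r : R, eigenvalue M r%:C -> c0 + c1 * r = g r) ->
  is_fcalc cdot g (mulmxr M) (mulmxr (c0%:C%:M + c1%:C *: M)).
Proof.
move=> gE e e0; exists (c0%:P + c1 *: 'X); split=> [r /spectrum_mulmxr/gE <-|x].
  by rewrite !hornerE subrr normr0 ltW.
have h0 : hnorm cdot 0 = 0.
  apply/eqP; rewrite -sqrf_eq0 sqr_hnorm big1// => k _.
  by rewrite mxE /= expr0n addr0.
rewrite [X in hnorm _ X](_ : _ = 0); first by rewrite h0 mulr_ge0 ?hnorm_ge0 ?ltW.
have sz : (size (c0%:P + c1 *: 'X)%R <= 2)%N.
  rewrite (leq_trans (size_polyD _ _))// geq_max.
  by rewrite (leq_trans (size_polyC_leq1 _))// (leq_trans (size_scale_leq _ _))// size_polyX.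
have -> : poly_op (c0%:P + c1 *: 'X) (mulmxr M) x =
    \sum_(k < 2) ((c0%:P + c1 *: 'X)`_k)%:C *: iter k (mulmxr M) x.
  rewrite /poly_op (big_ord_widen 2 (fun k => ((c0%:P + c1 *: 'X)`_k)%:C *: iter k (mulmxr M) x))//.
  rewrite big_mkcond; apply: eq_bigr => k _; case: ltnP => // lk.
  by rewrite nth_default// scale0r.
rewrite !big_ord_recl big_ord0 /= !coefD !coefC !coefZ !coefX /=.
rewrite mulr0 mulr1 add0r !addr0 mulmxDr mul_mx_scalar -scalemxAr.
by rewrite subrr.
Qed.

Lemma conj_cmx m k (W : 'M[R]_(m, k)) : map_mx Num.conj (cmx W) = cmx W.
Proof.
by apply/matrixP => i j; rewrite !mxE conj_Creal//; apply/complex_realP; exists (W i j).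
Qed.

(** Brings inequalities between operators on C^n back to real quadratic
forms, the only test vectors needed being the real ones. *)
Lemma dotmx_cmx_quad_form (x : 'rV[R]_n) M :
  cdot (cmx x *m cmx M) (cmx x) = ((x *m M *m x^T) 0 0)%:C.
Proof. by rewrite dotmxE -map_trmx conj_cmx map_trmx -!map_mxM mxE. Qed.

Lemma self_adjoint_cmx M : M^T = M -> self_adjoint cdot (mulmxr (cmx M)).
Proof.
move=> MT x y; rewrite /= !dotmxE trmx_mul (map_trmx _ M) MT map_mxM conj_cmx.
by rewrite mulmxA.
Qed.

(** Writing the gap as a Gram matrix makes its positivity
[<x W^*, x W^*> >= 0] immediate over C as well as over R. *)
Lemma op_le_cmx m (W : 'M[R]_(m, n)) M N : M = N + W^T *m W ->
  op_le cdot (mulmxr (cmx N)) (mulmxr (cmx M)).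
Proof.
move=> -> x; rewrite /= map_mxD mulmxDr linearDl /= lerDl map_mxM mulmxA.
have -> : cdot (x *m cmx W^T *m cmx W) x = dotmx (x *m cmx W^T) (x *m cmx W^T).
  by rewrite !dotmxE trmx_mul map_mxM (map_trmx _ W^T) trmxK conj_cmx mulmxA.
by rewrite dnorm_ge0.
Qed.

End RealSymmetric.

Section MatrixMonotonicity.
Local Open Scope complex_scope.
Context {R : realType}.
Local Notation C := R[i].
Local Notation cmx := (map_mx (real_complex R)).

(** Replaces diagonalization: an annihilating quadratic polynomial locates the
spectrum, which is all that the functional calculus asks for. *)
Lemma eigenvalue_quadratic n (M : 'M[R]_n) (a b : R) (z : C) :
  (M - a%:M) *m (M - b%:M) = 0 -> eigenvalue (cmx M) z ->
  z = a%:C \/ z = b%:C.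
Proof.
move=> /(congr1 cmx); rewrite map_mx0 map_mxM !map_mxB !map_scalar_mx /= => Mab.
move=> /eigenvalueP[v vM v0].
have vB c : v *m (cmx M - c%:M) = (z - c) *: v.
  by rewrite mulmxBr vM mul_mx_scalar scalerBl.
have := congr1 (mulmx v) Mab.
rewrite mulmxA vB -scalemxAl vB scalerA mulmx0 => /eqP.
by rewrite scaler_eq0 (negbTE v0) orbF mulf_eq0 !subr_eq0 => /orP[] /eqP; auto.
Qed.

(** Operator monotonicity specialized to real matrices with at most two
spectral values each, where [g(A)] and [g(B)] become the affine interpolants
[p0 + p1 A] and [q0 + q1 B].  The cases [a1 = a2] and [b1 = b2] of scalar
matrices are included. *)
Lemma opmono_le_quad_form n m (g : R -> R) (A B : 'M[R]_n) (W : 'M[R]_(m, n))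
    (a1 a2 b1 b2 p0 p1 q0 q1 : R) (x : 'rV[R]_n) :
  operator_monotone g -> 0 < a1 -> 0 < a2 -> 0 < b1 -> 0 < b2 ->
  (A - a1%:M) *m (A - a2%:M) = 0 -> (B - b1%:M) *m (B - b2%:M) = 0 ->
  B^T = B -> A = B + W^T *m W ->
  p0 + p1 * a1 = g a1 -> p0 + p1 * a2 = g a2 ->
  q0 + q1 * b1 = g b1 -> q0 + q1 * b2 = g b2 ->
  (x *m (q0%:M + q1 *: B) *m x^T) 0 0 <= (x *m (p0%:M + p1 *: A) *m x^T) 0 0.
Proof.
move=> gm a10 a20 b10 b20 Aq Bq BT AB pa1 pa2 qb1 qb2.
have AT : A^T = A by rewrite AB raddfD/= trmx_mul trmxK BT.
have spec (M : 'M[R]_n) c d : 0 < c -> 0 < d -> (M - c%:M) *m (M - d%:M) = 0 ->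
    forall z, spectrum (@dotmx C n) (mulmxr (cmx M)) z -> 0 < z.
  by move=> c0 d0 Mq z /spectrum_mulmxr/(eigenvalue_quadratic Mq)[]->; rewrite ltcR.
have fc (M : 'M[R]_n) c d r0 r1 : (M - c%:M) *m (M - d%:M) = 0 ->
    r0 + r1 * c = g c -> r0 + r1 * d = g d ->
    is_fcalc (@dotmx C n) g (mulmxr (cmx M)) (mulmxr (cmx (r0%:M + r1 *: M))).
  move=> Mq rc rd; rewrite map_mxD map_mxZ map_scalar_mx /=.
  by apply: is_fcalc_affine => r /(eigenvalue_quadratic Mq)[] [->].
have := gm _ _ (@hilbert_dotmx R n) _ _ (bounded_mulmxr _) (bounded_mulmxr _)
  (self_adjoint_cmx AT) (self_adjoint_cmx BT) (spec _ _ _ a10 a20 Aq)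
  (spec _ _ _ b10 b20 Bq) (op_le_cmx AB) _ _
  (fc _ _ _ _ _ Aq pa1 pa2) (fc _ _ _ _ _ Bq qb1 qb2) (cmx x).
by rewrite /= !dotmx_cmx_quad_form lecR.
Qed.

(** The case of 1 x 1 matrices. *)
Lemma opmono_nondecreasing (g : R -> R) (a b : R) : operator_monotone g ->
  0 < a -> a <= b -> g a <= g b.
Proof.
move=> gm a0 ab; have b0 := lt_le_trans a0 ab.
have := @opmono_le_quad_form 1 1 g b%:M a%:M (Num.sqrt (b - a))%:M b b a a (g b) 0 (g a) 0
  1%:M gm b0 b0 a0 a0.
rewrite !subrr !mul0mx !tr_scalar_mx !scale0r !addr0 !mul0r !addr0.
rewrite !mul1mx !mulmx1 !mxE; apply => //.
by rewrite -scalar_mxM -expr2 sqr_sqrtr ?subr_ge0// -raddfD /= addrC subrK.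
Qed.

End MatrixMonotonicity.

(** * The four-point inequality *)

Section Interlacing.
Context {R : realType}.

Lemma mx2P (M N : 'M[R]_2) : M 0 0 = N 0 0 -> M 0 1 = N 0 1 -> M 1 0 = N 1 0 ->
  M 1 1 = N 1 1 -> M = N.
Proof.
move=> h00 h01 h10 h11; apply/matrixP => i j.
have I2 (k : 'I_2) : k = 0 \/ k = 1.
  by case: k => -[|[|//]] ?; [left|right]; apply: val_inj.
by case: (I2 i) => ->; case: (I2 j) => ->.
Qed.

(** A positive semidefinite binary form has nonnegative determinant: evaluate
it at the two rows of the adjugate, or at (1, 1) and (1, -1) when the diagonal
vanishes. *)
Lemma quad_form_det (u v w : R) :
  (forall s t, 0 <= u * s ^+ 2 + 2 * v * s * t + w * t ^+ 2) -> v ^+ 2 <= u * w.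
Proof.
move=> uvw.
have u0 : 0 <= u by have := uvw 1 0; nra.
have w0 : 0 <= w by have := uvw 0 1; nra.
have := uvw (- v) u; have := uvw w (- v); have := uvw 1 1; have := uvw 1 (-1).
move: u0; rewrite le_eqVlt => /orP[/eqP <-|u0]; last nra.
move: w0; rewrite le_eqVlt => /orP[/eqP <-|w0]; last nra.
by move=> *; have -> : v = 0 by lra.
Qed.

Definition sym2 (u v w : R) : 'M[R]_2 :=
  \matrix_(i, j) (if i == j then if i == 0 then u else w else v).

Lemma quad_form_sym2 (u v w s t : R) (x := \row_j (if j == 0 then s else t)) :
  (x *m sym2 u v w *m x^T) 0 0 = u * s ^+ 2 + 2 * v * s * t + w * t ^+ 2.
Proof. by do 3!rewrite !mxE ?big_ord_recl ?big_ord0 /=; ring. Qed.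

Lemma sym2_det (u v w u' v' w' : R) :
  (forall x : 'rV[R]_2, (x *m sym2 u v w *m x^T) 0 0 <= (x *m sym2 u' v' w' *m x^T) 0 0) ->
  (v' - v) ^+ 2 <= (u' - u) * (w' - w).
Proof.
move=> le; apply: quad_form_det => s t.
have := le (\row_j (if j == 0 then s else t)); rewrite !quad_form_sym2; lra.
Qed.

Lemma affine_sym2 (p q u v w : R) :
  p%:M + q *: sym2 u v w = sym2 (p + q * u) (q * v) (p + q * w).
Proof. by apply: mx2P; rewrite !mxE /=; ring. Qed.

(** Cayley-Hamilton, with the characteristic polynomial given by its roots. *)
Lemma sym2_annihilated (u v w a b : R) : a + b = u + w -> a * b = u * w - v ^+ 2 ->
  (sym2 u v w - a%:M) *m (sym2 u v w - b%:M) = 0.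
Proof.
move=> tr det; apply: mx2P; rewrite !mxE !big_ord_recl big_ord0 !mxE /=;
  rewrite ?mulr1n ?mulr0n; nra.
Qed.

(** The rank-one perturbation [diag (c, d) + w^T w] with [w = (sqrt s, sqrt t)]
has characteristic polynomial [(X - c) (X - d) - s (X - d) - t (X - c)].
Equating it with [(X - a) (X - b)] at [X = c] and [X = d] gives [s] and [t],
and the interlacing [c < a < d < b] is what makes them positive.  The claim is,
up to a positive factor, that the difference of the images of the two matrices
under [g] has nonnegative determinant. *)
Lemma opmono_interlacing (g : R -> R) (c a d b : R)
    (P := (g a - g c) / (a - c)) (Q := (g d - g a) / (d - a))
    (m := (g b - g a) / (b - a)) : operator_monotone g ->
  0 < c -> c < a -> a < d -> d < b ->
  P * Q * (d - c) + Q * m * (b - d) <= P * m * (b - c).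
Proof.
move=> gm c0 ca ad db.
have [ca0 ad0 db0] : [/\ a - c != 0, d - a != 0 & b - a != 0].
  by split; rewrite subr_eq0; lra.
have [a0 d0 b0] : [/\ 0 < a, 0 < d & 0 < b] by split; lra.
have dc0 : d - c != 0 by rewrite subr_eq0; lra.
pose s := (a - c) * (b - c) / (d - c); pose t := (d - a) * (b - d) / (d - c).
have s0 : 0 <= s by rewrite divr_ge0 ?mulr_ge0//; lra.
have t0 : 0 <= t by rewrite divr_ge0 ?mulr_ge0//; lra.
pose W : 'rV[R]_2 := \row_j (if j == 0 then Num.sqrt s else Num.sqrt t).
pose r := Num.sqrt s * Num.sqrt t.
have r2 : r ^+ 2 = s * t by rewrite exprMn !sqr_sqrtr.
have AB : sym2 (c + s) r (d + t) = sym2 c 0 d + W^T *m W.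
  apply: mx2P; rewrite !mxE !big_ord_recl big_ord0 !mxE /=.
  - by rewrite -expr2 sqr_sqrtr// addr0.
  - by rewrite addr0 add0r.
  - by rewrite addr0 add0r mulrC.
  - by rewrite -expr2 sqr_sqrtr// addr0.
pose q := (g d - g c) / (d - c).
have key : (m * r - q * 0) ^+ 2 <=
    (g a - m * a + m * (c + s) - (g c - q * c + q * c)) *
    (g a - m * a + m * (d + t) - (g c - q * c + q * d)).
  apply: sym2_det => x.
  rewrite -(affine_sym2 _ _ c 0 d) -(affine_sym2 _ _ (c + s) r (d + t)).
  apply: (@opmono_le_quad_form _ _ _ g (sym2 (c + s) r (d + t)) (sym2 c 0 d) W a b c d) => //.
  - by apply: sym2_annihilated; rewrite ?r2 /s /t; field.
  - by apply: sym2_annihilated; ring.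
  - by apply: mx2P; rewrite !mxE.
  - by rewrite subrK.
  - by rewrite /m; field.
  - by rewrite subrK.
  - by rewrite /q; field.
have gcE : g c = g a - P * (a - c) by rewrite /P; field.
have gdE : g d = g a + Q * (d - a) by rewrite /Q; field.
have qE : g c - q * c + q * d = g d by rewrite /q; field.
have sE : c - a + s = (a - c) * (b - d) / (d - c) by rewrite /s; field.
have tE : d - a + t = (d - a) * (b - c) / (d - c) by rewrite /t; field.
(* The factor that relates the claim to the determinant. *)
pose k := (a - c) * (d - a) / (d - c).
have k0 : 0 < k by rewrite divr_gt0 ?mulr_gt0//; lra.
rewrite -subr_ge0 -(pmulr_rge0 _ k0).
rewrite (_ : k * _ = (m * (c - a + s) + (g a - g c)) *
  (m * (d - a + t) - (g d - g a)) - m ^+ 2 * r ^+ 2); last first.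
  by rewrite gcE gdE sE tE r2 /k /s /t; field.
rewrite subr_ge0; move: key; rewrite qE subrK mulr0 subr0 exprMn; lra.
Qed.

End Interlacing.

(** * Strict monotonicity and continuity *)

Section KarcherClass.
Context {R : realType}.
Implicit Types g : R -> R.

(** To the left of the flat pair: with the pair as [d, b] and [x] as [a], a gap
[g x < g a] would contradict the four-point inequality.  To its right: with the
pair as [c, a], the slope [P] vanishes and the inequality becomes
[Q * m <= 0]. *)
Lemma opmono_const g (a b : R) : operator_monotone g -> 0 < a -> a < b ->
  g a = g b -> forall x, 0 < x -> g x = g a.
Proof.
move=> gm a0 ab gab x x0.
have gle := opmono_nondecreasing gm.
have [xa|ax] := ltP x a.
  apply/eqP; rewrite eq_le gle ?(ltW xa)//= leNgt; apply/negP => gxa.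
  have c0 : 0 < x / 2 by rewrite divr_gt0.
  have cx : x / 2 < x by lra.
  have := opmono_interlacing gm c0 cx xa ab; rewrite -gab.
  set c := x / 2 in c0 cx *; set P := (g x - g c) / (x - c).
  have P0 : 0 <= P by rewrite divr_ge0 ?subr_ge0 ?gle// ltW.
  (* Only the sign of P matters from here on. *)
  clearbody P.
  have k0 : 0 < (a - x) * (b - x) / (g a - g x) by rewrite divr_gt0 ?mulr_gt0 ?subr_gt0//; lra.
  (* This factor clears the denominators of the slopes Q and m. *)
  rewrite -(ler_pM2l k0) => le.
  have : 0 <= P * (b - a) * (x - c) by rewrite !mulr_ge0//; lra.
  have : 0 < (g a - g x) * (b - a) by rewrite mulr_gt0//; lra.
  suff : P * (a - c) * (b - x) + (g a - g x) * (b - a) <= P * (b - c) * (a - x) by lra.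
  apply: le_trans (le_trans le _); rewrite le_eqVlt; apply/orP; left; apply/eqP; field;
    rewrite !subr_eq0; apply/andP; split; lra.
have [xb|bx] := leP x b.
  by apply/eqP; rewrite eq_le {1}gab !gle.
apply/eqP; rewrite eq_le [X in _ && X]gle// andbT leNgt; apply/negP => gax.
have := @opmono_interlacing _ g a b x (x + 1) gm a0 ab bx; rewrite -gab subrr !mul0r add0r.
have gx1 : g x <= g (x + 1) by rewrite gle//; lra.
rewrite ltrDl ltr01 => /(_ isT); apply/negP; rewrite -ltNge.
by rewrite !mulr_gt0 ?invr_gt0 ?subr_gt0//; lra.
Qed.

(** The normalization [g'(1) = 1] enters only here, to exclude constant
functions. *)
Lemma karcher_class_increasing g (a b : R) : karcher_class g -> 0 < a -> a < b -> g a < g b.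
Proof.
case=> gm g1 dg a0 ab; rewrite lt_neqAle (opmono_nondecreasing gm a0 (ltW ab)) andbT.
apply/eqP => gab; have flat := opmono_const gm a0 ab gab.
suff : is_derive (1 : R) (1 : R) g 0.
  by move=> [_ d0]; have := oner_neq0 R; case: dg => _; rewrite d0 => ->; rewrite eqxx.
apply: (near_eq_is_derive (f := cst (g a))) => //.
near=> x; rewrite flat//; near: x; exact: lt_nbhsr.
Unshelve. all: by end_near. Qed.

(** In the four-point inequality take [c = l / 2] and [b = u + 1]: as these
stay at distance at least [l / 2] and [1] from [x] and [y], the bound on the
slope does not depend on [x] and [y]. *)
Lemma karcher_class_lipschitz g (l u x y : R) : karcher_class g -> 0 < l -> l <= x -> x < y ->
  y <= u -> g y - g x <= ((u + 1 - l / 2) / (l / 2) * (g (u + 1) - g l)) * (y - x).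
Proof.
move=> kg l0 lx xy yu; have [gm _ _] := kg.
have inc a b := @karcher_class_increasing g a b kg.
have c0 : 0 < l / 2 by rewrite divr_gt0.
have cx : l / 2 < x by lra.
have yb : y < u + 1 by lra.
have := opmono_interlacing gm c0 cx xy yb.
set c := l / 2 in c0 cx *; set b := u + 1 in yb *.
set P := _ / _; set Q := _ / _; set m := _ / _ => le.
have P0 : 0 < P by rewrite divr_gt0 ?subr_gt0// inc.
have Q0 : 0 < Q by rewrite divr_gt0 ?subr_gt0// inc//; lra.
have m0 : 0 < m by rewrite divr_gt0 ?subr_gt0 ?inc//; lra.
have gyE : g y - g x = Q * (y - x) by rewrite /Q divfK// subr_eq0; lra.
rewrite gyE ler_pM2r ?subr_gt0//.
have m_le : m <= g b - g l.
  rewrite ler_pdivrMr; last lra.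
  have : g l <= g x by apply: opmono_nondecreasing gm l0 lx.
  have : g x < g b by apply: inc; lra.
  have : 1 <= b - x by rewrite /b; lra.
  nra.
clearbody P Q m.
have QmP : Q * (y - c) <= m * (b - c).
  rewrite -(ler_pM2l P0); have : 0 <= Q * m * (b - y) by rewrite !mulr_ge0//; lra.
  lra.
rewrite mulrAC ler_pdivlMr//.
apply: (@le_trans _ _ (Q * (y - c))); first by rewrite ler_wpM2l ?(ltW Q0)// /c; lra.
apply: (le_trans QmP); rewrite mulrC ler_wpM2l//; lra.
Qed.

Lemma karcher_class_continuous g (x : R) : karcher_class g -> 0 < x -> {for x, continuous g}.
Proof.
move=> kg x0.
pose l := x / 2; pose u := x + 1.
have l0 : 0 < l by rewrite divr_gt0.
pose K := (u + 1 - l / 2) / (l / 2) * (g (u + 1) - g l).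
have K0 : 0 < K.
  rewrite mulr_gt0//; first by rewrite divr_gt0//; rewrite /u /l; lra.
  by rewrite subr_gt0; apply: karcher_class_increasing kg _ _; rewrite /u /l; lra.
have lip y z : l <= y -> y <= z -> z <= u -> `|g z - g y| <= K * (z - y).
  rewrite [y <= z]le_eqVlt => ly /orP[/eqP<-|yz] zu; first by rewrite !subrr normr0 mulr0.
  have gyz : g y < g z by apply: karcher_class_increasing kg _ yz; lra.
  by rewrite gtr0_norm ?subr_gt0//; exact: karcher_class_lipschitz.
apply/cvgrPdist_lt => e e0; near=> y.
have yl : l <= y by apply: ltW; near: y; apply: lt_nbhsr; rewrite /l; lra.
have yu : y <= u by apply: ltW; near: y; apply: lt_nbhsl; rewrite /u; lra.
have yx : `|x - y| < e / K.
  near: y; apply: (@cvgr_dist_lt _ _ _ _ _ id); first exact: cvg_id.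
  by rewrite divr_gt0.
have := yx; rewrite ltr_pdivlMr// mulrC; apply: le_lt_trans.
have [xy|yx'] := leP x y.
  rewrite distrC [`|x - y|]distrC [`|y - x|]ger0_norm ?subr_ge0//.
  by apply: lip => //; rewrite /l; lra.
rewrite [`|x - y|]gtr0_norm ?subr_gt0//.
by apply: lip => //; rewrite ?ltW// /u; lra.
Unshelve. all: by end_near. Qed.

End KarcherClass.

(** * The root of the Karcher equation *)

Section Root.
Context {R : realType}.
Implicit Types g : R -> R.

Lemma karcher_root_exists g (lam x : R) : karcher_class g -> 0 < lam < 1 ->
  0 < x -> exists y, karcher_root g lam x y.
Proof.
move=> kg /andP[l0 l1] x0; have [_ g1 _] := kg.
have gcont u : 0 < u -> {for u, continuous g} by exact: karcher_class_continuous.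
have gle u v : 0 < u -> u <= v -> g u <= g v.
  by case: kg => gm _ _; exact: opmono_nondecreasing.
(* The Karcher equation in the variable u = 1 / y. *)
pose h u := (1 - lam) * g u + lam * g (x * u).
(* For u = a both u and x * u are at most 1, for u = b both are at least 1;
   so the two terms of h have the same sign there, as g 1 = 0. *)
pose a := Num.min 1 x^-1; pose b := Num.max 1 x^-1.
have a0 : 0 < a by rewrite lt_min ltr01 invr_gt0.
have ab : a <= b by rewrite ge_min le_max lexx.
have ax1 : x * a <= 1 by rewrite mulrC -ler_pdivlMr// mul1r ge_min lexx orbT.
have bx1 : 1 <= x * b by rewrite mulrC -ler_pdivrMr// mul1r le_max lexx orbT.
have a1 : a <= 1 by rewrite ge_min lexx.
have b1 : 1 <= b by rewrite le_max lexx.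
have ha : h a <= 0.
  have := gle _ _ a0 a1; have := gle _ _ (mulr_gt0 x0 a0) ax1; rewrite g1 /h; nra.
have hb : 0 <= h b.
  have := gle _ _ ltr01 b1; have := gle _ _ ltr01 bx1; rewrite g1 /h; nra.
have hc : {within `[a, b], continuous h}.
  apply: continuous_in_subspaceT => u; rewrite inE/= in_itv/= => /andP[au _].
  have u0 := lt_le_trans a0 au.
  have gxc : g (x * v) @[v --> u] --> g (x * u).
    apply: (@continuous_comp _ _ _ (fun v => x * v) g).
      by apply: cvgM; [exact: cvg_cst|exact: cvg_id].
    by apply: gcont; rewrite mulr_gt0.
  by apply: cvgD; apply: cvgM; [exact: cvg_cst|exact: gcont|exact: cvg_cst|].
have [|u] := @IVT R h a b 0 ab hc; first by rewrite ge_min ha le_max hb orbT.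
rewrite in_itv/= => /andP[au _] hu; exists u^-1; split.
  by rewrite invr_gt0 (lt_le_trans a0).
by rewrite div1r invrK.
Qed.

Lemma karcher_root_unique g (lam x y z : R) : karcher_class g -> 0 < lam < 1 ->
  0 < x -> karcher_root g lam x y -> karcher_root g lam x z -> y = z.
Proof.
move=> kg /andP[l0 l1] x0.
wlog yz : y z / y < z => [wl [y0 yE] [z0 zE]|[y0 yE] [z0 zE]].
  have [yz|zy|//] := ltgtP y z; first exact: (wl y z).
  by symmetry; exact: (wl z y).
have iyz : z^-1 < y^-1 by rewrite ltf_pV2.
have : g (1 / z) < g (1 / y).
  by rewrite !div1r; apply: karcher_class_increasing => //; rewrite invr_gt0.
have : g (x / z) < g (x / y).
  by apply: karcher_class_increasing => //; rewrite ?divr_gt0// ltr_pM2l.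
move: yE zE; nra.
Qed.

(** The root exists and is unique, so [f_lambda] never takes its default value
0 on (0, +oo). *)
Lemma f_lambdaP g (lam x : R) : karcher_class g -> 0 < lam < 1 -> 0 < x ->
  karcher_root g lam x (f_lambda g lam x).
Proof.
move=> kg hl x0; have [y yr] := karcher_root_exists kg hl x0.
rewrite /f_lambda; case: xgetP => [_ _ []//|/(_ y)[]].
by split=> // z; exact: karcher_root_unique.
Qed.

End Root.

Theorem proposition1 (R : realType) (g : R -> R) (lam : R)
    (hg : karcher_class g) (hlam : 0 < lam < 1) :
  {in `]0, +oo[%classic &, injective (f_lambda g lam)} /\
  forall x : R, (f_lambda g lam @` `]0, +oo[) x ->
    (g @` `]0, +oo[) (- ((1 - lam) / lam) * g (1 / x)) /\
    pos_inv (f_lambda g lam) x =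
      x * pos_inv g (- ((1 - lam) / lam) * g (1 / x)).
Proof.
have lam0 : lam != 0 by case/andP: hlam => /lt0r_neq0.
have posE (x : R) : (x \in `]0, +oo[%classic) = (0 < x).
  by rewrite mem_setE in_itv/= andbT.
have g_inj : {in `]0, +oo[%classic &, injective g}.
  move=> u v; rewrite !posE => u0 v0 guv; apply/eqP.
  have [uv|vu|//] := ltgtP u v.
    by have := karcher_class_increasing hg u0 uv; rewrite guv ltxx.
  by have := karcher_class_increasing hg v0 vu; rewrite guv ltxx.
have root x : 0 < x -> 0 < f_lambda g lam x /\
    g (x / f_lambda g lam x) = - ((1 - lam) / lam) * g (1 / f_lambda g lam x).
  move=> x0; have [y0 yE] := f_lambdaP hg hlam x0; split=> //.
  apply: (mulfI lam0).
  rewrite (_ : lam * g _ = - ((1 - lam) * g (1 / f_lambda g lam x))); last lra.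
  by field.
have f_inj : {in `]0, +oo[%classic &, injective (f_lambda g lam)}.
  move=> u v; rewrite !posE => u0 v0 fuv.
  have [fu0 uE] := root u u0; have [fv0 vE] := root v v0.
  have : u / f_lambda g lam u = v / f_lambda g lam u.
    by apply: g_inj; rewrite ?posE ?divr_gt0// uE fuv vE.
  by move=> /(congr1 ( *%R^~ (f_lambda g lam u))); rewrite /= !divfK ?gt_eqF.
split=> [|z [x /=]]; first exact: f_inj.
rewrite in_itv/= andbT => x0 <-.
have [y0 <-] := root x x0; have xy0 := divr_gt0 x0 y0.
split; first by exists (x / f_lambda g lam x) => //=; rewrite in_itv/= xy0.
rewrite /pos_inv !pinvKV ?posE// mulrC divfK// gt_eqF//.
Qed.
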